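(* Let $p(\cdot)\in\mathcal{P}_0$. Then, for any matrix weight $W$ (with values in $M_m$) and any cube $Q$ in $\mathbb{R}^n$, the reducing operator $A_Q$ of order $p(\cdot)$ for $W$ exists; that is, there exists a positive definite and self-adjoint matrix $A_Q\in M_m$ such that, for any $\vec z\in\mathbb{C}^m$, $$|A_Q\vec z|\sim\frac{1}{\|\mathbf{1}_Q\|_{L^{p(\cdot)}}}\left\|\,|W(\cdot)\vec z|\,\mathbf{1}_Q\right\|_{L^{p(\cdot)}},$$ where the positive equivalence constants depend only on $m$ and $p(\cdot)$.
   Context: $m,n\in\mathbb{N}$; $M_m$ is the set of $m\times m$ complex matrices. $\mathcal{P}_0$ is the set of measurable $p:\mathbb{R}^n\to(0,\infty]$ with $\operatorname{ess\,inf}_{x\in\mathbb{R}^n}p(x)>0$. For a measurable function $f$ on $\mathbb{R}^n$, $\|f\|_{L^{p(\cdot)}}:=\inf\{\lambda\in(0,\infty):\rho(f/\lambda)\le1\}$, where $\rho(f):=\int_{\mathbb{R}^n}|f(x)|^{p(x)}\,dx$ when $p(\cdot)$ is finite and, in general, $\rho(f):=\int_{\{p<\infty\}}|f(x)|^{p(x)}\,dx+\|f\|_{L^\infty(\{p=\infty\})}$. Cubes have finite edge length and edges parallel to the coordinate axes (not necessarily open or closed). A matrix weight is a matrix-valued function $W:\mathbb{R}^n\to M_m$ such that $W(x)$ is nonnegative definite and invertible for almost every $x\in\mathbb{R}^n$ and the entries of $W$ are all locally integrable. $f\sim g$ means $c\,g\le f\le C\,g$ for positive constants $c,C$.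
   Formalization: The formal theorem also assumes that the norm of |W(·)z|1_Q in L^{p(·)} is finite for every z, for the given W and Q; without this the claim fails (m=n=1, p=2, W(x)=|x|^{-1/2}, Q=(0,1)), and the condition is necessary for a reducing operator to exist. *)

(* Defs.v *)
From HB Require Import structures.
From mathcomp Require Import all_boot all_order all_algebra.
From mathcomp Require Import all_classical all_reals all_analysis.
From mathcomp Require Import measurable_realfun ess_sup_inf hoelder complex.

Set Implicit Arguments.
Unset Strict Implicit.
Unset Printing Implicit Defensive.

Import Order.TTheory GRing.Theory Num.Theory.
Import numFieldNormedType.Exports.

Local Open Scope classical_set_scope.
Local Open Scope ring_scope.
Local Open Scope complex_scope.
Local Open Scope sesquilinear_scope.

(* Lebesgue measure on R^n is taken as the Caratheodory measure of the usual
   outer measure on 'rV[R]_n, so that "measurable" on Rn below means Lebesgue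
   (not only Borel) measurable. *)
Section lebesgue_Rn.
Context {R : realType} (n : nat).
Local Open Scope ereal_scope.

Definition box (a b : 'rV[R]_n) : set 'rV[R]_n :=
  [set x | forall i, (a 0%R i < x 0%R i <= b 0%R i)%R].

Definition box_volume (a b : 'rV[R]_n) : R :=
  (\prod_(i < n) Num.max 0 (b 0 i - a 0 i))%R.

(* The index set D allows finite covers too, which matters only when n = 0,
   where no box is empty. *)
Definition lebesgue_outer (A : set 'rV[R]_n) : \bar R :=
  ereal_inf [set s | exists (D : set nat) (a b : nat -> 'rV[R]_n),
    A `<=` \bigcup_(k in D) box (a k) (b k) /\
    s = \esum_(k in D) (box_volume (a k) (b k))%:E].

Lemma box_volume_ge0 a b : 0 <= (box_volume a b)%:E.
Proof. by rewrite lee_fin; apply: prodr_ge0 => i _; rewrite le_max lexx. Qed.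

Lemma lebesgue_outer_ge0 A : 0 <= lebesgue_outer A.
Proof.
apply: le_ereal_inf_tmp => _ [D [a [b [_ ->]]]].
by apply: esum_ge0 => k _; exact: box_volume_ge0.
Qed.

Lemma lebesgue_outer0 : lebesgue_outer set0 = 0.
Proof.
apply/eqP; rewrite eq_le lebesgue_outer_ge0 andbT.
apply: ereal_inf_lbound; exists set0, (fun=> 0%R), (fun=> 0%R).
by split => //; rewrite esum_set0.
Qed.

Lemma lebesgue_outer_subadditive A F :
  subset_sigma_subadditive lebesgue_outer A F.
Proof.
move=> AF; have [[i ioo]|] := pselect (exists i, lebesgue_outer (F i) = +oo).
  rewrite (eseries_pinfty _ _ ioo) ?leey// => k _.
  by rewrite -ltNye (lt_le_trans _ (lebesgue_outer_ge0 _)).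
rewrite -forallNE => Foo.
suff add2e (e : {posnum R}) :
    lebesgue_outer A <= \sum_(i <oo) lebesgue_outer (F i) + e%:num%:E.
  by apply/lee_addgt0Pr => _/posnumP[].
rewrite (le_trans _ (epsilon_trick _ _ _))//; last first.
  by move=> k; exact: lebesgue_outer_ge0.
pose P k (B : set nat * ((nat -> 'rV[R]_n) * (nat -> 'rV[R]_n))) :=
  F k `<=` \bigcup_(j in B.1) box (B.2.1 j) (B.2.2 j) /\
  \esum_(j in B.1) (box_volume (B.2.1 j) (B.2.2 j))%:E <=
    lebesgue_outer (F k) + (e%:num / (2 ^ k.+1)%:R)%:E.
have [G PG] : {G & forall k, P k (G k)}.
  apply: (@choice _ _ P) => k.
  have ek : (0 < e%:num / (2 ^ k.+1)%:R :> R)%R by [].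
  have /(lb_ereal_inf_adherent ek)[x [D [a [b [Fk ->]]]] xS] :
      lebesgue_outer (F k) \is a fin_num.
    by rewrite ge0_fin_numE ?lebesgue_outer_ge0// ltey; apply/eqP/Foo.
  by exists (D, (a, b)); split => //; exact/ltW.
have /ppcard_eqP[f] := card_nat2.
pose v (ij : nat * nat) : \bar R :=
  (box_volume ((G ij.1).2.1 ij.2) ((G ij.1).2.2 ij.2))%:E.
pose K := [set: nat] `*`` (fun i => (G i).1).
apply: (@le_trans _ _ (\esum_(ij in K) v ij)).
  apply: ereal_inf_lbound; exists (f @` K).
  exists (fun j => (G (f^-1%FUN j).1).2.1 (f^-1%FUN j).2).
  exists (fun j => (G (f^-1%FUN j).1).2.2 (f^-1%FUN j).2); split.
    move=> x /AF[i _ /(PG i).1[j Dj xj]].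
    by exists (f (i, j)); [exists (i, j)|rewrite /= funK ?inE].
  rewrite esum_image; last by move=> x y _ _; apply: inj; rewrite inE.
  by apply: eq_esum => ij _; rewrite /v funK ?inE.
have -> : \esum_(ij in K) v ij =
    \esum_(i in setT) \esum_(j in (G i).1) v (i, j).
  by rewrite esum_esum// => i j _ _; exact: box_volume_ge0.
rewrite -nneseries_esumT; last first.
  by move=> i; apply: esum_ge0 => j _; exact: box_volume_ge0.
apply: lee_nneseries => [i _|i _]; last exact: (PG i).2.
by move=> *; apply: esum_ge0 => j _; exact: box_volume_ge0.
Qed.

HB.instance Definition _ := isSubsetOuterMeasure.Build R 'rV[R]_n
  lebesgue_outer lebesgue_outer0 lebesgue_outer_ge0 lebesgue_outer_subadditive.

Definition Rn := caratheodory_type lebesgue_outer.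

HB.instance Definition _ := Measurable.on Rn.

Definition lebesgue : set Rn -> \bar R := lebesgue_outer.

Let lebesgue0 : lebesgue set0 = 0.
Proof. exact: lebesgue_outer0. Qed.

Let lebesgue_ge0 (A : set Rn) : 0 <= lebesgue A.
Proof. exact: lebesgue_outer_ge0. Qed.

Let lebesgue_sigma_additive : semi_sigma_additive lebesgue.
Proof.
by move=> F mF tF mUF; exact: caratheodory_measure_sigma_additive.
Qed.

HB.instance Definition _ := isMeasure.Build _ Rn R lebesgue
  lebesgue0 lebesgue_ge0 lebesgue_sigma_additive.

Definition is_cube (Q : set Rn) := exists (a : 'rV[R]_n) (l : R)
    (u v : 'I_n -> bool), (0 < l)%R /\
  Q = [set x : 'rV[R]_n | forall i, x 0%R i \in
        Interval (BSide (u i) (a 0%R i)) (BSide (v i) (a 0%R i + l)%R)].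

End lebesgue_Rn.
Arguments Rn : clear implicits.
Arguments lebesgue : clear implicits.

Section variable_lebesgue.
Context {R : realType} {n : nat}.
Local Open Scope ereal_scope.
Local Notation mu := (lebesgue R n).

Definition variable_exponent (p : Rn R n -> \bar R) :=
  [/\ measurable_fun setT p, forall x, 0 < p x & 0 < ess_inf mu p].

(* Extending f by 0 outside [set x | p x = +oo] gives the L^oo norm over that
   set, with value 0 (and not -oo) when the set is negligible. *)
Definition modular (p : Rn R n -> \bar R) (f : Rn R n -> R) : \bar R :=
  \int[mu]_(x in [set x | p x < +oo]) (`|f x| `^ fine (p x))%:E +
  'N[mu]_+oo[EFin \o (f \_ [set x | p x = +oo])].

(* The value is +oo when no l is admissible. *)
Definition variable_norm (p : Rn R n -> \bar R) (f : Rn R n -> R) : \bar R :=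
  ereal_inf [set l%:E | l in
    [set l : R | (0 < l)%R /\ modular p (fun x => f x / l)%R <= 1]].

End variable_lebesgue.

Section matrix_weight.
Context {R : realType} {m : nat}.

Definition vnorm (z : 'cV[R[i]]_m) : R :=
  Num.sqrt (\sum_(i < m) Normc.normc (z i 0) ^+ 2).

(* The order of R[i] makes these conditions include that z^* A z is real. *)
Definition nonneg_definite (A : 'M[R[i]]_m) :=
  forall z : 'cV[R[i]]_m, 0 <= (z ^t* *m A *m z) 0 0.

Definition pos_definite (A : 'M[R[i]]_m) :=
  forall z : 'cV[R[i]]_m, z != 0 -> 0 < (z ^t* *m A *m z) 0 0.

Definition locally_integrable_Rn n (f : Rn R n -> R) :=
  measurable_fun setT f /\
  forall K : set 'rV[R]_n, compact K ->
    (lebesgue R n).-integrable K (EFin \o f).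

(* Local integrability does not make the variable norm of |W z| 1_Q finite:
   take m = n = 1, p = 2, W(x) = |x|^(-1/2) and Q = ]0, 1[. *)
Definition matrix_weight n (W : Rn R n -> 'M[R[i]]_m) :=
  {ae lebesgue R n, forall x, nonneg_definite (W x) /\ W x \in unitmx} /\
  forall i j, locally_integrable_Rn (fun x => complex.Re (W x i j)) /\
              locally_integrable_Rn (fun x => complex.Im (W x i j)).

End matrix_weight.

(* Main.v *)
Require Import Defs.
From HB Require Import structures.
From mathcomp Require Import all_boot all_order all_algebra.
From mathcomp Require Import all_classical all_reals all_analysis.
From mathcomp Require Import measurable_realfun ess_sup_inf hoelder complex.
From mathcomp Require Import ring lra.

Set Implicit Arguments.
Unset Strict Implicit.
Unset Printing Implicit Defensive.

Import Order.TTheory GRing.Theory Num.Theory.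
Import numFieldNormedType.Exports.

Local Open Scope classical_set_scope.
Local Open Scope ring_scope.
Local Open Scope complex_scope.
Local Open Scope sesquilinear_scope.

(** Write N(z) for the quotient of the variable norms of |W z| 1_Q and of 1_Q.
The reducing operator exists because N is a quasi-norm on C^m whose
quasi-triangle constant depends only on p, and because every quasi-norm on C^m
is equivalent to z |-> |A z| for some positive definite A, with constants that
depend only on m and on the quasi-triangle constant.

The quasi-triangle inequality [variable_norm_quasi_triangle] comes from two
facts about the modular rho. Since (|f| + |g|) / (l + l') is a convex
combination of |f| / l and |g| / l', it lies below their pointwise maximum, so
that rho ((f + g) / (l + l')) <= rho (f / l) + rho (g / l') whatever the
exponent is [modular_le_max]. And if p >= r almost everywhere with 0 < r <= 1,
then rho (f / K) <= K^(-r) rho f for K >= 1 [modular_scale]; the choice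
K = 2^(1/r) absorbs the factor 2. The second fact also shows that the norm
vanishes only on functions that are null almost everywhere. Hence N(z) = 0
forces W z = 0 almost everywhere on Q, and then z = 0, because W is almost
everywhere invertible and Q has positive measure.

That Q is measurable, with positive and finite measure, is proved from the
outer measure itself: a hyperplane cuts a box into two boxes whose volumes add
up, so half-spaces satisfy the Caratheodory condition, and a box is not covered
by boxes of smaller total volume, by induction on the dimension.

The equivalence [quasi_norm_equiv_norm1] is an induction on the dimension. The
quotient of C^(1+m) by the first basis vector e carries the quasi-norm
w |-> inf_t N(t, w), with the same constant. The infimum is attained up to a
factor that depends only on K [quotient_norm_lift], which both makes the
quotient a quasi-norm (it vanishes only at 0) and allows a basis of the
quotient to be lifted to C^(1+m) with control of the norms. Coordinates in the
lifted basis completed by e give an invertible B with |B z| ~ N(z). A positive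
definite A with |A z| = |B z| for all z is the square root of B^* B
[polar_decomposition]. *)

(** * Quasi-norms on C^m *)

Section quasi_norm.
Context {R : realType}.
Local Notation normc := Normc.normc.

Lemma normc_ge0 (x : R[i]) : 0 <= normc x.
Proof. by case: x => a b; exact: sqrtr_ge0. Qed.

Lemma normc_eq0 (x : R[i]) : (normc x == 0) = (x == 0).
Proof.
apply/eqP/eqP => [|->]; [exact: Normc.eq0_normc|exact: Normc.normc0].
Qed.

Lemma sqr_normc_ReIm (x : R[i]) :
  normc x ^+ 2 = complex.Re x ^+ 2 + complex.Im x ^+ 2.
Proof. by case: x => a b /=; rewrite sqr_sqrtr// addr_ge0// sqr_ge0. Qed.

Lemma normc_le_ReIm (x : R[i]) :
  normc x <= `|complex.Re x| + `|complex.Im x|.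
Proof.
rewrite -(@ler_pXn2r _ 2) ?nnegrE ?normc_ge0 ?addr_ge0//.
rewrite sqr_normc_ReIm sqrrD !real_normK ?num_real//.
by rewrite lerD2r lerDl mulrn_wge0// mulr_ge0.
Qed.

Lemma normRe_le_normc (x : R[i]) : `|complex.Re x| <= normc x.
Proof.
rewrite -(@ler_pXn2r _ 2) ?nnegrE ?normc_ge0//.
by rewrite sqr_normc_ReIm real_normK ?num_real// lerDl sqr_ge0.
Qed.

Lemma normIm_le_normc (x : R[i]) : `|complex.Im x| <= normc x.
Proof.
rewrite -(@ler_pXn2r _ 2) ?nnegrE ?normc_ge0//.
by rewrite sqr_normc_ReIm real_normK ?num_real// lerDr sqr_ge0.
Qed.

Definition quasi_norm (K : R) m (N : 'cV[R[i]]_m -> R) :=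
  [/\ forall z, 0 <= N z,
      forall a z, N (a *: z) = normc a * N z,
      forall z w, N (z + w) <= K * (N z + N w) &
      forall z, N z = 0 -> z = 0].

Definition norm1 m (z : 'cV[R[i]]_m) : R := \sum_i normc (z i 0).

Lemma norm1_ge0 m (z : 'cV[R[i]]_m) : 0 <= norm1 z.
Proof. by apply: sumr_ge0 => i _; exact: normc_ge0. Qed.

Lemma quasi_norm0 (K : R) m (N : 'cV[R[i]]_m -> R) : quasi_norm K N -> N 0 = 0.
Proof. by move=> [_ NZ _ _]; rewrite -(scale0r 0) NZ Normc.normc0 mul0r. Qed.

Lemma quasi_norm_sum (K : R) m (N : 'cV[R[i]]_m -> R) k
    (F : 'I_k -> 'cV[R[i]]_m) : 1 <= K -> quasi_norm K N ->
  N (\sum_i F i) <= K ^+ k * \sum_i N (F i).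
Proof.
move=> K1 NK; have [N0 _ ND _] := NK.
have K0 : 0 <= K by exact: le_trans K1.
elim: k F => [|k IH] F.
  by rewrite !big_ord0 mulr0 (quasi_norm0 NK).
rewrite !big_ord_recr/= (le_trans (ND _ _))// exprS -mulrA ler_wpM2l//.
rewrite mulrDr lerD// ler_peMl//; exact: exprn_ege1.
Qed.

(** The intervals [f s - g s, f s + g s] meet pairwise, hence all together (Helly
on the line): the supremum of the left endpoints lies in each of them. *)
Lemma common_interval_point (T : Type) (t0 : T) (f g : T -> R) :
  (forall s t, f s - f t <= g s + g t) -> exists a, forall s, `|a - f s| <= g s.
Proof.
move=> fg; pose S := [set f s - g s | s in setT].
have ubS t : ubound S (f t + g t).
  by move=> _ [s _ <-]; have := fg s t; lra.
have S0 : S !=set0 by exists (f t0 - g t0), t0.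
exists (sup S) => s; rewrite ler_distl; apply/andP; split.
  by apply: ub_le_sup; [exists (f s + g s); exact: ubS|exists s].
by apply: ge_sup.
Qed.

(** Completeness of the scalars replaces compactness here. Two coefficients s and
s' are at distance at most g s + g s', where g s is proportional to
N (w + s e); so the real parts, and likewise the imaginary parts, have a common
approximation t within g s of every s. This t is nearly optimal. It also shows
that N (w + s e) stays away from 0 unless w is a multiple of e. *)
Lemma near_best_approximation (K : R) m (N : 'cV[R[i]]_m -> R)
    (e w : 'cV[R[i]]_m) : 0 < K -> quasi_norm K N -> e != 0 ->
  exists t, forall s, N (w + t *: e) <= K * (1 + 2 * K) * N (w + s *: e).
Proof.
move=> K0 [N0 NZ ND Neq0] e0.
have Ne : 0 < N e by rewrite lt_neqAle eq_sym N0 andbT; apply: contraNneq e0 => /Neq0 ->.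
pose g s := K * N (w + s *: e) / N e.
have dist s t : normc (s - t) <= g s + g t.
  rewrite /g -mulrDl ler_pdivlMr// -NZ.
  have -> : (s - t) *: e = (w + s *: e) + (-1) *: (w + t *: e).
    by rewrite scaleN1r opprD addrACA subrr add0r scalerBl.
  rewrite (le_trans (ND _ _))// NZ.
  have -> : normc (-1) = 1 :> R by rewrite normcN Normc.normc1.
  by rewrite mul1r mulrDr.
(* t is built from a common point for the real parts and one for the imaginary
   parts. *)
have [a aP] : exists a, forall s, `|a - complex.Re s| <= g s.
  apply: (common_interval_point 0) => s t; apply: le_trans (dist s t).
  by rewrite -raddfB; apply: le_trans (normRe_le_normc _); exact: ler_norm.
have [b bP] : exists b, forall s, `|b - complex.Im s| <= g s.
  apply: (common_interval_point 0) => s t; apply: le_trans (dist s t).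
  by rewrite -raddfB; apply: le_trans (normIm_le_normc _); exact: ler_norm.
exists (Complex a b) => s.
have -> : w + (Complex a b) *: e = (w + s *: e) + (Complex a b - s) *: e.
  by rewrite -addrA -scalerDl [s + _]addrC subrK.
rewrite (le_trans (ND _ _))// NZ -mulrA ler_wpM2l ?(ltW K0)// mulrDl mul1r.
rewrite lerD2l -ler_pdivlMr// (le_trans (normc_le_ReIm _))//.
rewrite (_ : 2 * K * _ / _ = g s + g s); last by rewrite /g; ring.
by case: s => c d; rewrite lerD// ?(aP (Complex c d))// (bP (Complex c d)).
Qed.

Section quotient.
Variables (K : R) (m : nat) (N : 'cV[R[i]]_(1 + m) -> R).
Hypotheses (K1 : 1 <= K) (NK : quasi_norm K N).

Definition quotient_norm (w : 'cV[R[i]]_m) : R :=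
  inf [set N (col_mx s%:M w) | s in setT].

Lemma quotient_norm_le s w : quotient_norm w <= N (col_mx s%:M w).
Proof.
by apply: ge_inf; [exists 0 => _ [t _ <-]; case: NK|exists s].
Qed.

Lemma le_quotient_norm x w :
  (forall s, x <= N (col_mx s%:M w)) -> x <= quotient_norm w.
Proof.
move=> xN; apply: lb_le_inf; first by exists (N (col_mx 0%:M w)), 0.
by move=> _ [s _ <-].
Qed.

Lemma quotient_norm_lift w :
  exists t, N (col_mx t%:M w) <= K * (1 + 2 * K) * quotient_norm w.
Proof.
have K0 : 0 < K by exact: lt_le_trans K1.
pose e : 'cV[R[i]]_(1 + m) := col_mx 1%:M 0.
have e0 : e != 0.
  apply/eqP => /colP/(_ (lshift m ord0)); rewrite col_mxEu !mxE/=.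
  by move=> /eqP; rewrite oner_eq0.
have eE s : col_mx s%:M w = col_mx 0 w + s *: e.
  by rewrite scale_col_mx scaler0 add_col_mx add0r addr0 scale_scalar_mx mulr1.
have [t tP] := near_best_approximation (col_mx 0 w) K0 NK e0.
exists t; rewrite -ler_pdivrMl ?mulr_gt0// ?addr_gt0 ?mulr_gt0//.
apply: le_quotient_norm => s; rewrite ler_pdivrMl ?mulr_gt0// ?addr_gt0 ?mulr_gt0//.
by rewrite !eE.
Qed.

Lemma quasi_norm_quotient : quasi_norm K quotient_norm.
Proof.
have K0 : 0 < K by exact: lt_le_trans K1.
have [N0 NZ ND Neq0] := NK.
have q0 z : 0 <= quotient_norm z by exact: le_quotient_norm.
have qZ a z : a != 0 -> quotient_norm (a *: z) <= normc a * quotient_norm z.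
  move=> a0; have na : 0 < normc a by rewrite lt_neqAle normc_ge0 eq_sym normc_eq0 a0.
  rewrite -ler_pdivrMl//; apply: le_quotient_norm => s; rewrite ler_pdivrMl// -NZ.
  by rewrite scale_col_mx scale_scalar_mx quotient_norm_le.
split => //.
- move=> a z; have [->|a0] := eqVneq a 0.
    rewrite scale0r Normc.normc0 mul0r; apply/eqP; rewrite eq_le q0 andbT.
    apply: le_trans (quotient_norm_le 0 0) _.
    by rewrite raddf0 col_mx0 (quasi_norm0 NK).
  apply/eqP; rewrite eq_le qZ//=.
  have na : 0 < normc a by rewrite lt_neqAle normc_ge0 eq_sym normc_eq0 a0.
  rewrite -ler_pdivlMl// -Normc.normcV -[z in leLHS](scalerK a0).
  by rewrite qZ// invr_eq0.
- move=> z w; rewrite -ler_pdivrMl// -lerBlDr.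
  apply: le_quotient_norm => s; rewrite lerBlDr -lerBlDl.
  apply: le_quotient_norm => t; rewrite lerBlDl ler_pdivrMl//.
  rewrite (le_trans (quotient_norm_le (s + t) _))//.
  by rewrite raddfD/= -add_col_mx.
- move=> z z0; have [t] := quotient_norm_lift z.
  rewrite z0 mulr0 => Nle.
  have : N (col_mx t%:M z) = 0 by apply/eqP; rewrite eq_le Nle N0.
  by move=> /Neq0; rewrite -col_mx0 => /eq_col_mx[].
Qed.

End quotient.

Lemma norm1_col_mx m (s : R[i]) (w : 'cV[R[i]]_m) :
  norm1 (col_mx s%:M w) = normc s + norm1 w.
Proof.
rewrite /norm1 big_split_ord big_ord1/= col_mxEu mxE eqxx mulr1n; congr (_ + _).
by apply: eq_bigr => i _; rewrite col_mxEd.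
Qed.

(** Induction on the dimension through the quotient by the first basis vector.
C is chosen before N: it depends only on K and m. *)
Lemma quasi_norm_equiv_norm1 (K : R) m : 1 <= K -> exists C : R, 0 < C /\
  forall N : 'cV[R[i]]_m -> R, quasi_norm K N ->
  exists2 B : 'M[R[i]]_m, B \in unitmx &
    forall z, norm1 (B *m z) <= C * N z /\ N z <= C * norm1 (B *m z).
Proof.
move=> K1; have K0 : 0 < K by exact: lt_le_trans K1.
elim: m => [|m [C [C0 IH]]].
  exists 1; split => // N NK; exists 1%:M => [|z]; first exact: unitmx1.
  rewrite (flatmx0 (_ *m z)) (flatmx0 z) /norm1 big_ord0 mulr0.
  by rewrite (quasi_norm0 NK) mulr0 lexx.
pose D := K * (1 + 2 * K) * C; pose E := K ^+ m * D.
have D0 : 0 < D by rewrite !mulr_gt0// addr_gt0// mulr_gt0.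
have E0 : 0 < E by rewrite mulr_gt0// exprn_gt0.
exists (K * (1 + E) + (K * (1 + E * C) + C)); split.
  by rewrite !addr_gt0// mulr_gt0// addr_gt0// mulr_gt0.
rewrite -[m.+1]/(1 + m)%N => N NK; have [N0 NZ ND Neq0] := NK.
have [B Bu BP] := IH _ (quasi_norm_quotient K1 NK).
have /choice[T TP] := quotient_norm_lift K1 NK.
(* The basis of the quotient in which B reads coordinates, and its lifts. *)
pose w i : 'cV[R[i]]_m := invmx B *m delta_mx i 0.
pose z i : 'cV[R[i]]_(1 + m) := col_mx (T (w i))%:M (w i).
have Nz i : N (z i) <= D.
  rewrite (le_trans (TP _))// /D ler_wpM2l ?mulr_ge0 ?addr_ge0 ?mulr_ge0 ?(ltW K0)//.
  apply: le_trans (BP _).2 _; rewrite mulKVmx// /norm1 (bigD1 i)//= big1.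
    by rewrite mxE !eqxx Normc.normc1 addr0 mulr1.
  by move=> j ji; rewrite mxE (negPf ji) Normc.normc0.
pose e : 'cV[R[i]]_(1 + m) := col_mx 1%:M 0.
have Ne : 0 < N e.
  rewrite lt_neqAle eq_sym N0 andbT; apply/negP => /eqP /Neq0.
  move=> /colP/(_ (lshift m ord0)); rewrite col_mxEu !mxE/=.
  by move=> /eqP; rewrite oner_eq0.
pose r : 'rV[R[i]]_m := \row_i T (w i).
(* A reads coordinates in the basis made of e / N e and the lifts z i. *)
pose A : 'M[R[i]]_(1 + m) :=
  block_mx (N e)%:C%:M (- (N e)%:C *: (r *m B)) 0 B.
exists A.
  rewrite unitmxE det_ublock unitrM -[_ && _]/(_ && (B \in unitmx)) Bu andbT.
  by rewrite det_scalar1 unitfE eq_complex/= eqxx andbT gt_eqF.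
move=> x; pose t := x (lshift m ord0) 0; pose v := @dsubmx _ 1 m 1 x; pose c := B *m v.
have xE : x = col_mx t%:M v.
  rewrite -[LHS](@vsubmxK _ 1 m 1); congr col_mx.
  by apply/matrixP => i j; rewrite !ord1 !mxE eqxx.
pose d := t - (r *m c) 0 0.
have AxE : A *m x = col_mx (((N e)%:C * d)%:M) c.
  rewrite xE mul_block_col mul0mx add0r; congr col_mx.
  rewrite -scalar_mxM -scalemxAl -mulmxA -/c; apply/matrixP => i j.
  rewrite !ord1 [LHS]mxE [X in X + _]mxE [X in _ + X]mxE [RHS]mxE eqxx.
  by rewrite mulrBr mulNr.
have nAx : norm1 (A *m x) = N (d *: e) + norm1 c.
  by rewrite AxE norm1_col_mx Normc.normcM NZ mulrC/= expr0n addr0 sqrtr_sqr ger0_norm.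
have xD : x = d *: e + \sum_i c i 0 *: z i.
  rewrite /z; under eq_bigr do rewrite scale_col_mx.
  have -> : \sum_(i < m) col_mx (c i 0 *: (T (w i))%:M) (c i 0 *: w i) =
      col_mx (r *m c) v.
    apply/matrixP => j k; rewrite summxE ord1; have [l ->|l ->] := split_ordP j.
      rewrite col_mxEu ord1 [RHS]mxE; apply: eq_bigr => i _.
      by rewrite col_mxEu !mxE eqxx mulr1n mulrC.
    rewrite col_mxEd -[v](mulKmx Bu) -/c [RHS]mxE; apply: eq_bigr => i _.
    by rewrite col_mxEd /w -colE !mxE mulrC.
  rewrite scale_col_mx scaler0 add_col_mx add0r {1}xE; congr col_mx.
  rewrite scale_scalar_mx mulr1; apply/matrixP => i j.
  by rewrite !ord1 [LHS]mxE [RHS]mxE [X in X + _]mxE eqxx !mulr1n subrK.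
have Nsum : N (\sum_i c i 0 *: z i) <= E * norm1 c.
  apply: le_trans (quasi_norm_sum _ K1 NK) _.
  rewrite -mulrA ler_wpM2l ?exprn_ge0 ?(ltW K0)//.
  rewrite /norm1 mulr_sumr ler_sum// => i _; rewrite NZ mulrC ler_wpM2r ?normc_ge0//.
have cN : norm1 c <= C * N x.
  apply: le_trans (BP _).1 _; rewrite ler_wpM2l ?(ltW C0)//.
  by rewrite [in leRHS]xE (quotient_norm_le NK).
rewrite nAx; split.
  rewrite addrC mulrDl.
  have dN : N (d *: e) <= K * (1 + E * C) * N x.
    have -> : d *: e = x + (-1) *: \sum_i c i 0 *: z i by rewrite scaleN1r {1}xD addrK.
    rewrite (le_trans (ND _ _))// -mulrA ler_wpM2l ?(ltW K0)// mulrDl mul1r lerD2l.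
    rewrite NZ normcN Normc.normc1 mul1r (le_trans Nsum)// -mulrA ler_wpM2l// ltW//.
  have := N0 x; have : 0 <= K * (1 + E) * N x.
    by rewrite !mulr_ge0// ?addr_ge0// ?ltW.
  lra.
rewrite [in leLHS]xD (le_trans (ND _ _))// mulrDl.
apply: le_trans (_ : K * (1 + E) * (N (d *: e) + norm1 c) <= _); last first.
  rewrite lerDl; apply: mulr_ge0; last by rewrite addr_ge0 ?norm1_ge0.
  by apply/ltW; rewrite addr_gt0// mulr_gt0// addr_gt0// mulr_gt0.
rewrite -mulrA ler_wpM2l ?(ltW K0)//.
rewrite mulrDl mul1r mulrDr -addrA lerD2l (le_trans Nsum)//.
by rewrite addrA lerDr addr_ge0 ?norm1_ge0// mulr_ge0// ltW.
Qed.
End quasi_norm.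

(** * Euclidean norm, Gram matrices and the polar decomposition *)

Section polar.
Context {R : realType}.
Local Notation normc := Normc.normc.

Lemma vnorm_ge0 m (z : 'cV[R[i]]_m) : 0 <= vnorm z.
Proof. exact: sqrtr_ge0. Qed.

Lemma sqr_vnorm m (z : 'cV[R[i]]_m) : vnorm z ^+ 2 = \sum_i normc (z i 0) ^+ 2.
Proof. by rewrite sqr_sqrtr// sumr_ge0// => i _; exact: sqr_ge0. Qed.

Lemma normc_le_vnorm m (z : 'cV[R[i]]_m) i : normc (z i 0) <= vnorm z.
Proof.
rewrite -(@ler_pXn2r _ 2) ?nnegrE ?normc_ge0 ?vnorm_ge0//.
by rewrite sqr_vnorm (bigD1 i)//= lerDl sumr_ge0// => j _; exact: sqr_ge0.
Qed.

Lemma vnorm_le_norm1 m (z : 'cV[R[i]]_m) : vnorm z <= norm1 z.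
Proof.
rewrite -(@ler_pXn2r _ 2) ?nnegrE ?norm1_ge0 ?vnorm_ge0//.
rewrite sqr_vnorm expr2 /norm1 mulr_suml ler_sum// => i _.
rewrite expr2 ler_wpM2l ?normc_ge0// (bigD1 i)//= lerDl sumr_ge0// => j _.
exact: normc_ge0.
Qed.

Lemma norm1_le_vnorm m (z : 'cV[R[i]]_m) : norm1 z <= m%:R * vnorm z.
Proof.
rewrite mulr_natl -[X in _ *+ X](card_ord m) -sumr_const.
by apply: ler_sum => i _; exact: normc_le_vnorm.
Qed.

Lemma vnormZ m a (z : 'cV[R[i]]_m) : vnorm (a *: z) = normc a * vnorm z.
Proof.
apply/eqP; rewrite -(@eqrXn2 _ 2) ?mulr_ge0 ?normc_ge0 ?vnorm_ge0//.
rewrite exprMn !sqr_vnorm mulr_sumr; apply/eqP/eq_bigr => i _.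
by rewrite mxE Normc.normcM exprMn.
Qed.

Lemma vnorm_eq0 m (z : 'cV[R[i]]_m) : (vnorm z == 0) = (z == 0).
Proof.
apply/eqP/eqP => [z0|->]; last by rewrite -(scale0r 0) vnormZ Normc.normc0 mul0r.
apply/colP => i; rewrite mxE; apply: Normc.eq0_normc; apply/eqP.
by rewrite eq_le normc_ge0 -z0 normc_le_vnorm.
Qed.

(** The factor 2 spares the Cauchy-Schwarz inequality, and only enlarges a
quasi-triangle constant. *)
Lemma vnormD m (z w : 'cV[R[i]]_m) : vnorm (z + w) <= 2 * (vnorm z + vnorm w).
Proof.
have h0 := vnorm_ge0 z; have h1 := vnorm_ge0 w.
rewrite -(@ler_pXn2r _ 2) ?nnegrE ?vnorm_ge0 ?mulr_ge0 ?addr_ge0//.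
apply: le_trans (_ : 2 * (vnorm z ^+ 2 + vnorm w ^+ 2) <= _); last nra.
rewrite !sqr_vnorm -big_split/= mulr_sumr ler_sum// => i _; rewrite mxE.
set a := normc (z i 0); set b := normc (w i 0).
apply: le_trans (_ : (a + b) ^+ 2 <= _); last by have := sqr_ge0 (a - b); nra.
by rewrite ler_pXn2r ?nnegrE ?addr_ge0 ?normc_ge0// le_normcD.
Qed.

Lemma dotmx_vnorm m (z : 'cV[R[i]]_m) :
  (z ^t* *m z) 0 0 = (vnorm z ^+ 2)%:C%C.
Proof.
rewrite sqr_vnorm mxE rmorph_sum; apply: eq_bigr => i _.
by rewrite !mxE mulrC -normCK rmorphXn/=; case: (z i 0).
Qed.

Lemma vnorm_mulmx_sqr m k (B : 'M[R[i]]_(k, m)) (z : 'cV[R[i]]_m) :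
  (z ^t* *m (B ^t* *m B) *m z) 0 0 = (vnorm (B *m z) ^+ 2)%:C%C.
Proof. by rewrite -dotmx_vnorm trmx_mul map_mxM/= !mulmxA. Qed.

Lemma pos_definite_gram m (B : 'M[R[i]]_m) :
  B \in unitmx -> pos_definite (B ^t* *m B).
Proof.
move=> Bu z z0; rewrite vnorm_mulmx_sqr ltcR exprn_gt0// lt_neqAle vnorm_ge0.
rewrite eq_sym vnorm_eq0 andbT; apply: contra_neq z0 => Bz.
by rewrite -(mulKmx Bu z) Bz mulmx0.
Qed.

Lemma gram_selfadjoint m k (B : 'M[R[i]]_(k, m)) :
  (B ^t* *m B) ^t* = B ^t* *m B.
Proof. by rewrite trmx_mul map_mxM/= trmxCK. Qed.

Lemma gram_sqr m (P P' D : 'M[R[i]]_m) : P *m P' = 1%:M ->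
  P' *m D *m (D *m P) *m (P' *m D *m (D *m P)) =
  P' *m (D *m D *m (D *m D)) *m P.
Proof. by move=> PP'; rewrite !mulmxA -[_ *m P *m P']mulmxA PP' mulmx1. Qed.

(** With B^* B = P^* diag(d) P, the matrix A is P^* diag(sqrt d) P. It is obtained as
the Gram matrix of G = diag(d^(1/4)) P, so that self-adjointness and positive
definiteness need no computation. *)
Lemma polar_decomposition m (B : 'M[R[i]]_m) : B \in unitmx ->
  exists A : 'M[R[i]]_m, [/\ pos_definite A, A ^t* = A &
    forall z, vnorm (A *m z) = vnorm (B *m z)].
Proof.
move=> Bu; set H := B ^t* *m B.
have Hherm : H ^t* = H by exact: gram_selfadjoint.
have : H \is normalmx by apply/normalmxP; rewrite Hherm.
move=> /orthomx_spectralP; set P := spectralmx H; set d := spectral_diag H => HE.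
have Pu : P \is unitarymx by exact: spectral_unitarymx.
have PP : P *m P ^t* = 1%:M by exact/unitarymxP.
rewrite invmx_unitary// in HE.
have dE : diag_mx d = P *m H *m P ^t*.
  by rewrite HE !mulmxA PP mul1mx -mulmxA PP mulmx1.
have d0 i : 0 < d 0 i.
  pose u : 'cV[R[i]]_m := P ^t* *m delta_mx i 0.
  have -> : d 0 i = (u ^t* *m H *m u) 0 0.
    transitivity ((delta_mx 0 i *m diag_mx d *m delta_mx i (0 : 'I_1)) (0 : 'I_1) 0).
      by rewrite -rowE -colE !mxE eqxx.
    by rewrite dE /u trmx_mul map_mxM/= trmxCK trmx_delta map_delta_mx !mulmxA.
  apply: pos_definite_gram => //; rewrite /u.
  apply/eqP => /(congr1 (mulmx P)); rewrite mulmxA PP mul1mx mulmx0.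
  by move=> /matrixP/(_ i 0); rewrite !mxE !eqxx => /eqP; rewrite oner_eq0.
pose q i := Num.sqrt (Num.sqrt (complex.Re (d 0 i))).
have q0 i : 0 < q i.
  by rewrite !sqrtr_gt0; have := d0 i; rewrite ltcE => /andP[].
have q4 i : ((q i ^+ 2) ^+ 2)%:C%C = d 0 i.
  rewrite !sqr_sqrtr ?sqrtr_ge0//; last first.
    by have := d0 i; rewrite ltcE => /andP[_ /ltW].
  by apply/RRe_real/gtr0_real.
pose D : 'M[R[i]]_m := diag_mx (\row_i (q i)%:C%C).
have Dherm : D ^t* = D.
  rewrite tr_diag_mx map_diag_mx; congr diag_mx; apply/rowP => i.
  by rewrite !mxE; apply/CrealP; rewrite realE ler0c ltW.
have D4 : D *m D *m (D *m D) = diag_mx d.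
  rewrite !mulmx_diag; congr diag_mx; apply/rowP => i; rewrite !mxE.
  by rewrite -!expr2 -!rmorphXn/= q4.
pose G := D *m P.
have Gu : G \in unitmx.
  rewrite unitmx_mul (unitarymx_unit Pu) andbT unitmxE det_diag unitfE.
  by apply/prodf_neq0 => i _; rewrite mxE eq_complex/= eqxx andbT gt_eqF.
exists (G ^t* *m G); split; [exact: pos_definite_gram|exact: gram_selfadjoint|].
have GH : (G ^t* *m G) ^t* *m (G ^t* *m G) = H.
  have Gherm : G ^t* = P ^t* *m D by rewrite /G trmx_mul map_mxM/= Dherm.
  by rewrite gram_selfadjoint Gherm (gram_sqr D PP) D4 [RHS]HE.
move=> z; apply/eqP; rewrite -(@eqrXn2 _ 2) ?vnorm_ge0//; apply/eqP/complexI.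
by rewrite -[LHS]vnorm_mulmx_sqr GH -[RHS]vnorm_mulmx_sqr.
Qed.

End polar.

(** * Lebesgue measure of boxes and cubes *)

Section lebesgue_boxes.
Context {R : realType}.

Definition itv_length (a b : R) : R := Num.max 0 (b - a).

Lemma itv_length_ge0 a b : 0 <= itv_length a b.
Proof. by rewrite /itv_length le_max lexx. Qed.

Lemma lebesgue_measure_oc (a b : R) :
  lebesgue_measure `]a, b]%classic = (itv_length a b)%:E.
Proof.
rewrite lebesgue_measure_itv/= lte_fin /itv_length; case: ltP => ab.
  by rewrite -EFinB max_r// subr_ge0 ltW.
by rewrite max_l// subr_le0.
Qed.

(** Cavalieri's principle: for fixed t, the slices at height t of the covering boxes
cover the slice of the box, which bounds its volume by the induction hypothesis;
integrating over t in the last edge and exchanging sum and integral adds one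
dimension. The weights c absorb the indicator of the last coordinate, and the
index set of a cover. *)
Lemma volume_le_cover n (a b : nat -> R) (a_ b_ : nat -> nat -> R)
    (c : nat -> R) :
  (forall k, 0 <= c k) ->
  (forall x : nat -> R, (forall i, (i < n)%N -> a i < x i <= b i) ->
    (1 <= \sum_(k <oo)
      (c k * \prod_(i < n) \1_(`]a_ k i, b_ k i]%classic) (x i))%:E)%E) ->
  ((\prod_(i < n) itv_length (a i) (b i))%:E <=
    \sum_(k <oo) (c k * \prod_(i < n) itv_length (a_ k i) (b_ k i))%:E)%E.
Proof.
elim: n c => [|n IH] c c0 cover.
  have := cover (fun=> 0); rewrite big_ord0 => /(_ (fun i => ltac:(by []))).
  under eq_eseriesr do rewrite big_ord0.
  by under [in X in _ -> X]eq_eseriesr do rewrite big_ord0.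
pose V := \prod_(i < n) itv_length (a i) (b i).
pose V_ k := \prod_(i < n) itv_length (a_ k i) (b_ k i).
have V_ge0 k : 0 <= V_ k by apply: prodr_ge0 => i _; exact: itv_length_ge0.
have slice t : a n < t <= b n ->
    (V%:E <= \sum_(k <oo) ((c k * V_ k) * \1_(`]a_ k n, b_ k n]%classic) t)%:E)%E.
  move=> abt; under eq_eseriesr do rewrite mulrAC.
  apply: IH => [k|x xab]; first by rewrite mulr_ge0.
  pose y i := if i == n then t else x i.
  rewrite (eq_eseriesr (g := fun k =>
    (c k * \prod_(i < n.+1) \1_(`]a_ k i, b_ k i]%classic) (y i))%:E)).
    apply: cover => i; rewrite ltnS /y; case: eqVneq => [->//|ni ile].
    by apply: xab; rewrite ltn_neqAle ni.
  move=> k _; rewrite big_ord_recr/= /y eqxx mulrAC -mulrA; congr (c k * (_ * _))%:E.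
  by apply: eq_bigr => i _; rewrite ltn_eqF.
rewrite big_ord_recr/= -/V EFinM -lebesgue_measure_oc -integral_cst//.
pose f k (t : R) : \bar R :=
  ((c k * V_ k) * \1_(`]a_ k n, b_ k n]%classic) t)%:E.
have mf k (D : set R) : measurable_fun D (f k).
  apply/measurable_EFinP/measurable_funM => //; exact: measurable_indic.
have f_ge0 k t : (0 <= f k t)%E by rewrite lee_fin !mulr_ge0.
apply: (@le_trans _ _ (\int[lebesgue_measure]_(t in `]a n, b n]%classic)
    \sum_(k <oo) f k t)%E).
  apply: ge0_le_integral => //.
  - by move=> t _; rewrite lee_fin prodr_ge0// => i _; exact: itv_length_ge0.
  - by apply: (@ge0_emeasurable_sum _ _ _ _ f xpredT).
rewrite integral_nneseries//; last by move=> k; exact: mf.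
apply: lee_nneseries => k _.
  by move=> _; exact: integral_ge0.
rewrite /f; under eq_integral do rewrite EFinM.
rewrite ge0_integralZl_EFin//; last 2 first.
- by apply/measurable_EFinP; exact: measurable_indic.
- by rewrite mulr_ge0.
rewrite integral_indic// big_ord_recr/= mulrA [leRHS]EFinM lee_wpmul2l//.
  by rewrite lee_fin mulr_ge0.
rewrite -lebesgue_measure_oc; apply: le_measure; rewrite ?inE//.
exact: measurableI.
Qed.

Variable n : nat.

Lemma box_volume_le_outer (a b : 'rV[R]_n) :
  ((box_volume a b)%:E <= lebesgue_outer (box a b))%E.
Proof.
apply: le_ereal_inf_tmp => _ [D [a_ [b_ [cover ->]]]].
(* Coordinates indexed by nat, since the induction on the dimension needs them. *)
pose coord (x : 'rV[R]_n) i : R := oapp (x 0) 0 (insub i).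
have coordE x (i : 'I_n) : coord x i = x 0 i by rewrite /coord valK.
have volE x y : box_volume x y = \prod_(i < n) itv_length (coord x i) (coord y i).
  by apply: eq_bigr => i _; rewrite !coordE.
rewrite esum_mkcond -nneseries_esumT; last first.
  by move=> k; case: ifP => // _; exact: box_volume_ge0.
rewrite (eq_eseriesr (g := fun k =>
    (\1_D k *
      \prod_(i < n) itv_length (coord (a_ k) i) (coord (b_ k) i))%:E)); last first.
  by move=> k _; rewrite -volE indicE; case: (k \in D); rewrite ?mul1r ?mul0r.
rewrite volE; apply: (volume_le_cover (a_ := fun k => coord (a_ k))
  (b_ := fun k => coord (b_ k)) (c := \1_D)) => [k|x xab].
  by rewrite indicE ler0n.
pose y : 'rV[R]_n := \row_i x i.
have /cover[k Dk yk] : box a b y.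
  by move=> i; rewrite mxE -!coordE; exact: xab.
apply: le_trans (nneseries_lim_ge k.+1 _); last first.
  by move=> j _ _; rewrite lee_fin mulr_ge0 ?prodr_ge0// indicE ler0n.
rewrite big_nat_recr//= -[leLHS]add0e leeD ?sume_ge0//.
  by move=> j _; rewrite lee_fin mulr_ge0 ?prodr_ge0// indicE ler0n.
rewrite lee_fin indicE mem_set// mul1r big1// => i _.
rewrite indicE mem_set//= in_itv/= !coordE.
by have := yk i; rewrite mxE.
Qed.

Lemma lebesgue_outer_box (a b : 'rV[R]_n) :
  lebesgue_outer (box a b) = (box_volume a b)%:E.
Proof.
apply/eqP; rewrite eq_le box_volume_le_outer andbT.
apply: ereal_inf_lbound; exists [set 0%N], (fun=> a), (fun=> b); split.
  by move=> x xab; exists 0%N.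
by rewrite esum_set1// box_volume_ge0.
Qed.

Lemma box_volume_split (a b : 'rV[R]_n) (i : 'I_n) (c : R) :
  box_volume a b =
    box_volume a (\row_j if j == i then Num.min (b 0 j) c else b 0 j) +
    box_volume (\row_j if j == i then Num.max (a 0 j) c else a 0 j) b.
Proof.
have volE (x y : 'rV[R]_n) : box_volume x y = Num.max 0 (y 0 i - x 0 i) *
    \prod_(j < n | j != i) Num.max 0 (y 0 j - x 0 j).
  by rewrite /box_volume (bigD1 i).
rewrite !volE !mxE eqxx.
under [X in _ = _ * X + _]eq_bigr => j ji do rewrite mxE (negPf ji).
under [X in _ = _ + _ * X]eq_bigr => j ji do rewrite mxE (negPf ji).
rewrite -mulrDl; congr (_ * _); rewrite /Num.max /Num.min.
move: (a 0 i) (b 0 i) => x y.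
case: (ltP 0 (y - x)) => ?; case: (ltP y c) => ?; case: (ltP x c) => ?;
  do ?[case: ifP => ?]; lra.
Qed.

(** A half-space splits each box of a cover into two boxes with the same total
volume, so a cover of X yields covers of both parts of X. *)
Lemma measurable_halfspace (i : 'I_n) (c : R) :
  measurable ([set x : 'rV[R]_n | x 0 i <= c] : set (Rn R n)).
Proof.
apply: le_caratheodory_measurable => X /=; apply: le_ereal_inf_tmp.
move=> _ [D [a [b [XD ->]]]].
pose b' k : 'rV[R]_n := \row_j if j == i then Num.min (b k 0 j) c else b k 0 j.
pose a' k : 'rV[R]_n := \row_j if j == i then Num.max (a k 0 j) c else a k 0 j.
rewrite (eq_esum (b := fun k => ((box_volume (a k) (b' k))%:E +
    (box_volume (a' k) (b k))%:E)%E)); last first.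
  by move=> k _; rewrite -EFinD -box_volume_split.
rewrite esumD; try by move=> k _; exact: box_volume_ge0.
apply: leeD; apply: ereal_inf_lbound.
  exists D, a, b'; split => // x [/XD[k Dk xk] /= xc]; exists k => // j.
  have := xk j; rewrite mxE; case: eqVneq => // -> /andP[-> xb].
  by rewrite le_min xb xc.
exists D, a', b; split => // x [/XD[k Dk xk] /= /negP]; rewrite -ltNge => xc.
exists k => // j; have := xk j; rewrite mxE; case: eqVneq => // -> /andP[xa ->].
by rewrite gt_max xa xc.
Qed.

Lemma measurable_coord (i : 'I_n) :
  measurable_fun setT ((fun x : 'rV[R]_n => x 0 i) : Rn R n -> R).
Proof.
apply: (measurability _ (RGenOInfty.measurableE R)).
move=> _ [_ [c ->] <-]; rewrite setTI.
rewrite (_ : _ @^-1` _ = ~` [set x : 'rV[R]_n | x 0 i <= c]).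
  exact/measurableC/measurable_halfspace.
apply/seteqP; split => x /=; rewrite in_itv/= andbT.
  by rewrite ltNge => /negP.
by rewrite ltNge => /negP.
Qed.

Lemma measurable_cube (Q : set (Rn R n)) : is_cube Q -> measurable Q.
Proof.
move=> [a [l [u [v [_ ->]]]]].
pose J i := [set` Interval (BSide (u i) (a 0 i)) (BSide (v i) (a 0 i + l))].
rewrite (_ : [set _ | _] =
    \bigcap_(i in [set: 'I_n]) ((fun x : 'rV[R]_n => x 0 i) @^-1` J i)).
  apply: fin_bigcap_measurable => // i _.
  rewrite -[X in measurable X]setTI.
  by apply: (measurable_coord i measurableT); exact: measurable_itv.
by apply/seteqP; split => [x xQ i _|x xQ i]; [exact: xQ|exact: (xQ i I)].
Qed.

Lemma lebesgue_cube_gt0 (Q : set (Rn R n)) : is_cube Q -> (0 < lebesgue R n Q)%E.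
Proof.
move=> [a [l [u [v [l0 ->]]]]].
(* Half the edge: the cube may be open on the right. *)
pose b : 'rV[R]_n := \row_i (a 0 i + l / 2).
apply: lt_le_trans (_ : lebesgue_outer (box a b) <= _)%E.
  rewrite lebesgue_outer_box lte_fin prodr_gt0// => i _.
  by rewrite lt_max mxE addrAC subrr add0r divr_gt0// orbT.
apply: le_outer_measure => x xab i; have := xab i; rewrite mxE => /andP[ax xb].
by rewrite in_itv/=; case: (u i); case: (v i) => /=; lra.
Qed.

Lemma lebesgue_cube_lty (Q : set (Rn R n)) : is_cube Q -> (lebesgue R n Q < +oo)%E.
Proof.
move=> [a [l [u [v [l0 ->]]]]].
pose a' : 'rV[R]_n := \row_i (a 0 i - 1); pose b : 'rV[R]_n := \row_i (a 0 i + l).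
apply: (@le_lt_trans _ _ (lebesgue_outer (box a' b))); last first.
  by rewrite lebesgue_outer_box ltry.
apply: le_outer_measure => x xab i; have := xab i; rewrite !mxE.
by rewrite in_itv/=; case: (u i); case: (v i) => /=; lra.
Qed.

End lebesgue_boxes.

(** * The modular *)

Lemma measurable_fun_powR d (T : measurableType d) (R : realType)
    (f g : T -> R) : measurable_fun setT f -> measurable_fun setT g ->
  measurable_fun setT (fun x => f x `^ g x).
Proof.
move=> mf mg; rewrite /powR; apply: measurable_fun_ifT.
- by apply: measurable_fun_eqr => //; exact: measurable_cst.
- apply: measurableT_comp => //; apply: measurable_fun_ifT => //.
  by apply: measurable_fun_eqr => //; exact: measurable_cst.
- apply: measurableT_comp => //; apply: measurable_funM => //.
  by apply: measurableT_comp.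
Qed.

Section Linfty.
Context d {T : measurableType d} {R : realType}.
Variable mu : {measure set T -> \bar R}.
Local Open Scope ereal_scope.

Lemma Lnormy_leD (h f g : T -> \bar R) :
  (forall x, `|h x| <= `|f x| + `|g x|) ->
  'N[mu]_+oo[h] <= 'N[mu]_+oo[f] + 'N[mu]_+oo[g].
Proof.
move=> hfg; rewrite unlock; case: ifPn => _; last by rewrite adde0.
by apply: le_trans (ess_supD _ _ _); apply/le_ess_sup/nearW => x; exact: hfg.
Qed.

Lemma LnormyZ (f : T -> \bar R) (k : R) : (0 < k)%R ->
  'N[mu]_+oo[(fun x => k%:E * f x)] = k%:E * 'N[mu]_+oo[f].
Proof.
move=> k0; rewrite unlock; case: ifPn => _; last by rewrite mule0.
rewrite -ess_sup_pZl//; congr ess_sup; apply/funext => x /=.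
by rewrite abseM gee0_abs// lee_fin ltW.
Qed.

(** When the measure is zero, the norm is 0 by convention and the conclusion holds
because the whole space is negligible. *)
Lemma Lnormy_eq0 (f : T -> \bar R) :
  'N[mu]_+oo[f] = 0 -> {ae mu, forall x, f x = 0}.
Proof.
rewrite unlock; case: ifPn => [_ /abs_sup_eq0_ae_eq|].
  by apply: filterS => x; exact.
rewrite lt_neqAle measure_ge0 andbT negbK => /eqP muT _.
by exists setT; split => //; exact: esym.
Qed.

Lemma Lnormy_le_cst (f : T -> \bar R) (c : R) : (0 <= c)%R ->
  (forall x, `|f x| <= c%:E) -> 'N[mu]_+oo[f] <= c%:E.
Proof.
move=> c0 fc; rewrite unlock; case: ifPn => // _.
by apply/ess_supP; apply: nearW.
Qed.

End Linfty.

Section modular.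
Context {R : realType} {n : nat}.
Local Open Scope ereal_scope.
Local Notation mu := (lebesgue R n).
Variable p : Rn R n -> \bar R.
Hypothesis p_exp : variable_exponent p.

Let D := [set x | p x < +oo].
Let E := [set x | p x = +oo].

(** The only information on p that enters the constants. The bound by 1 lets the
essential supremum part, which is homogeneous of degree 1, obey the same
scaling estimate as the integral part. *)
Lemma exponent_ge : exists r : R,
  (0 < r <= 1)%R /\ {ae mu, forall x, r%:E <= p x}.
Proof.
have [_ _ inf0] := p_exp.
have [r /andP[r0 r1] rinf] : exists2 r : R, (0 < r <= 1)%R & r%:E <= ess_inf mu p.
  case: (ess_inf mu p) inf0 => [s s0|_|//].
    exists (Num.min s 1%R); first by rewrite lt_min ltr01 ge_min lexx orbT -lte_fin s0.
    by rewrite lee_fin ge_min lexx.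
  by exists 1%R; rewrite ?ltr01 ?lexx// leey.
exists r; split; first exact/andP.
exact/ess_infP.
Qed.

Lemma measurable_finite_exponent : measurable D.
Proof.
have [mp _ _] := p_exp; rewrite -[D]setTI; exact: measurable_lte.
Qed.

Lemma fine_exponent_gt0 x : D x -> (0 < fine (p x))%R.
Proof. by have [_ p0 _] := p_exp => Dx; rewrite fine_gt0// p0. Qed.

Lemma measurable_modular_integrand (f : Rn R n -> R) : measurable_fun setT f ->
  measurable_fun D (fun x => (`|f x| `^ fine (p x))%:E).
Proof.
move=> mf; apply: measurable_funTS; apply/measurable_EFinP.
apply: measurable_fun_powR; first exact: measurableT_comp.
by have [mp _ _] := p_exp; exact: measurableT_comp.
Qed.

Lemma integrand_ge0 (f : Rn R n -> R) x : 0 <= (`|f x| `^ fine (p x))%:E.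
Proof. by rewrite lee_fin powR_ge0. Qed.

Lemma modular_ge0 f : 0 <= modular p f.
Proof.
by rewrite adde_ge0 ?Lnorm_ge0//; apply: integral_ge0 => x _; exact: integrand_ge0.
Qed.

(** At each point |h|^p is at most the larger of |f|^p and |g|^p, hence at most their
sum, for every positive value of p(x). Convexity of the power is not involved, which is
why exponents below 1 are allowed. *)
Lemma modular_le_max (h f g : Rn R n -> R) :
  measurable_fun setT h -> measurable_fun setT f -> measurable_fun setT g ->
  (forall x, `|h x| <= Num.max `|f x| `|g x|)%R ->
  modular p h <= modular p f + modular p g.
Proof.
move=> mh mf mg hfg; have mD := measurable_finite_exponent; have mI := measurable_modular_integrand.
rewrite /modular -/D -/E addeACA; apply: leeD.
  rewrite -(ge0_integralD mu mD (fun x _ => integrand_ge0 f x) (mI f mf)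
    (fun x _ => integrand_ge0 g x) (mI g mg)).
  apply: (ge0_le_integral mu mD (fun x _ => integrand_ge0 h x) (mI h mh)).
  - exact: emeasurable_funD (mI f mf) (mI g mg).
  - move=> x Dx; rewrite -EFinD lee_fin; have px := ltW (fine_exponent_gt0 Dx).
    have := hfg x; rewrite le_max => /orP[hx|hx].
      apply: le_trans (ge0_ler_powR px _ _ hx) _; rewrite ?nnegrE//.
      by rewrite lerDl powR_ge0.
    apply: le_trans (ge0_ler_powR px _ _ hx) _; rewrite ?nnegrE//.
    by rewrite lerDr powR_ge0.
apply: Lnormy_leD => x /=; rewrite !patchE; case: ifP => _; last by rewrite normr0 adde0.
rewrite -EFinD lee_fin (le_trans (hfg x))// ge_max.
by rewrite lerDl lerDr !normr_ge0.
Qed.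

(** Pointwise (|f| / K)^p = K^(-p) |f|^p <= K^(-r) |f|^p. *)
Lemma modular_scale (r K : R) (f : Rn R n -> R) : (0 < r <= 1)%R ->
  {ae mu, forall x, r%:E <= p x} -> (1 <= K)%R -> measurable_fun setT f ->
  modular p (fun x => f x / K)%R <= ((K `^ r)^-1)%:E * modular p f.
Proof.
move=> /andP[r0 r1] pr K1 mf; have K0 : (0 < K)%R by exact: lt_le_trans K1.
have Kr0 : (0 < (K `^ r)^-1)%R by rewrite invr_gt0 powR_gt0.
have mfK : measurable_fun setT (fun x => f x / K)%R by exact: measurable_funM.
have mD := measurable_finite_exponent; have mI := measurable_modular_integrand.
rewrite /modular -/D -/E ge0_muleDr ?Lnorm_ge0//; last first.
  by apply: integral_ge0 => x _; exact: integrand_ge0.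
apply: leeD.
  rewrite -(ge0_integralZl_EFin mu mD (fun x _ => integrand_ge0 f x) (mI f mf)
    (ltW Kr0)).
  apply: (ae_ge0_le_integral mD (fun x _ => integrand_ge0 _ x) (mI _ mfK)).
  - by move=> x _; apply: mule_ge0; [rewrite lee_fin ltW|exact: integrand_ge0].
  - by apply: measurable_funeM; exact: mI.
  apply: filterS pr => x rx Dx; rewrite -EFinM lee_fin.
  rewrite normrM powRM// mulrC ler_wpM2r ?powR_ge0//.
  rewrite normfV (ger0_norm (ltW K0)) -(powR_inv1 (ltW K0)) -powRrM mulN1r powRN.
  rewrite lef_pV2 ?posrE ?powR_gt0// ler_powR// -lee_fin fineK//.
  by have [_ p0 _] := p_exp; rewrite ge0_fin_numE// ltW.
rewrite -LnormyZ//; apply: le_trans (Lnormy_leD _ (g := cst 0) _) _; last first.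
  by rewrite Lnorm0// adde0.
move=> x /=; rewrite normr0 adde0 !patchE; case: ifP => _; last first.
  by rewrite -[point]/(0%R : R) mulr0 normr0.
rewrite lee_fin !normrM [leRHS]mulrC ler_wpM2l// normfV.
rewrite (gtr0_norm K0) (gtr0_norm Kr0).
by rewrite lef_pV2 ?posrE ?powR_gt0// -[leRHS]powRr1 ?(ltW K0)// ler_powR.
Qed.

End modular.

(** * The variable Lebesgue norm *)

Section variable_norm.
Context {R : realType} {n : nat}.
Local Open Scope ereal_scope.
Local Notation mu := (lebesgue R n).
Variable p : Rn R n -> \bar R.

Lemma variable_norm_ge0 f : 0 <= variable_norm p f.
Proof.
by apply: le_ereal_inf_tmp => _ [l [l0 _] <-]; rewrite lee_fin ltW.
Qed.

Lemma variable_norm_le f (l : R) : (0 < l)%R ->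
  modular p (fun x => f x / l)%R <= 1 -> variable_norm p f <= l%:E.
Proof. by move=> l0 fl; apply: ereal_inf_lbound; exists l. Qed.

Lemma le_variable_norm f (y : \bar R) :
  (forall l : R, (0 < l)%R -> modular p (fun x => f x / l)%R <= 1 ->
    y <= l%:E) -> y <= variable_norm p f.
Proof. by move=> yl; apply: le_ereal_inf_tmp => _ [l [l0 fl] <-]; exact: yl. Qed.

Lemma variable_normZ f (c : R) : (0 < c)%R ->
  variable_norm p (fun x => c * f x)%R = c%:E * variable_norm p f.
Proof.
have le_ f' (c' : R) : (0 < c')%R ->
    variable_norm p (fun x => c' * f' x)%R <= c'%:E * variable_norm p f'.
  move=> c0; rewrite -lee_pdivrMl//; apply: le_variable_norm => l l0 fl.
  rewrite lee_pdivrMl// -EFinM; apply: variable_norm_le; first exact: mulr_gt0.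
  by under eq_fun do rewrite -mulf_div divff ?gt_eqF// mul1r.
move=> c0; apply/eqP; rewrite eq_le le_//= -lee_pdivlMl//.
apply: le_trans (le_ _ _ _); rewrite ?invr_gt0//.
by under eq_fun do rewrite mulKf ?gt_eqF//.
Qed.

Hypothesis p_exp : variable_exponent p.
Variable r : R.
Hypotheses (r01 : (0 < r <= 1)%R) (pr : {ae mu, forall x, r%:E <= p x}).

Let r0 : (0 < r)%R. Proof. by case/andP: r01. Qed.

Lemma powR_root_ge1 (M : R) : (1 <= M)%R -> (1 <= M `^ r^-1)%R.
Proof.
by move=> M1; rewrite -[leLHS](powRr0 M) ler_powR// invr_ge0 ltW.
Qed.

Lemma powR_rootK (M : R) : (0 <= M)%R -> ((M `^ r^-1) `^ r = M)%R.
Proof. by move=> M0; rewrite -powRrM mulVf ?gt_eqF// powRr1. Qed.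

(** The convex combination (|f| + |g|) / (l + l') of |f| / l and |g| / l' is below
their maximum, so its modular is at most 2; dividing by 2^(1/r) halves it. *)
Lemma variable_norm_quasi_triangle (h f g : Rn R n -> R) :
  measurable_fun setT h -> measurable_fun setT f -> measurable_fun setT g ->
  (forall x, `|h x| <= `|f x| + `|g x|)%R ->
  variable_norm p h <=
    (2 `^ r^-1)%R%:E * (variable_norm p f + variable_norm p g).
Proof.
move=> mh mf mg hfg; set K : R := (2 `^ r^-1)%R.
have K1 : (1 <= K)%R by apply: powR_root_ge1; lra.
have K0 : (0 < K)%R by exact: lt_le_trans K1.
have mdiv (u : Rn R n -> R) (c : R) : measurable_fun setT u ->
    measurable_fun setT (fun x : Rn R n => u x / c)%R.
  by move=> mu_; exact: measurable_funM.
have key (l l' : R) : (0 < l)%R -> (0 < l')%R ->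
    modular p (fun x => f x / l)%R <= 1 -> modular p (fun x => g x / l')%R <= 1 ->
    variable_norm p h <= K%:E * (l%:E + l'%:E).
  move=> l0 l'0 fl gl'; have ll'0 : (0 < l + l')%R by exact: addr_gt0.
  rewrite -EFinD -EFinM; apply: variable_norm_le; first exact: mulr_gt0.
  rewrite (_ : (fun x => _) = (fun x => h x / (l + l') / K)%R); last first.
    by apply/funext => x; rewrite [(K * _)%R]mulrC invfM mulrA.
  apply: le_trans (modular_scale p_exp r01 pr K1 (mdiv h (l + l')%R mh)) _.
  rewrite powR_rootK// lee_pdivrMl// mule1 -[2%R]/(1 + 1)%R EFinD.
  apply: le_trans (leeD fl gl').
  apply: (modular_le_max p_exp (mdiv h _ mh) (mdiv f _ mf) (mdiv g _ mg)).
  move=> x; rewrite !normrM !normfV !(gtr0_norm l0, gtr0_norm l'0, gtr0_norm ll'0).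
  set M := Num.max _ _; rewrite ler_pdivrMr// (le_trans (hfg x))// mulrDr.
  by apply: lerD; rewrite -ler_pdivrMr// /M le_max lexx ?orbT.
rewrite -lee_pdivrMl//; have [->|gfin] := eqVneq (variable_norm p g) +oo.
  by rewrite addey ?leey// gt_eqF// (lt_le_trans _ (variable_norm_ge0 f)).
rewrite -leeBlDr ?ge0_fin_numE ?variable_norm_ge0 ?ltey//.
apply: le_variable_norm => l l0 fl.
rewrite leeBlDr ?ge0_fin_numE ?variable_norm_ge0 ?ltey// -leeBlDl//.
apply: le_variable_norm => l' l'0 gl'.
by rewrite leeBlDl// lee_pdivrMl// key.
Qed.

(** If arbitrarily small l satisfy rho (f / l) <= 1, scaling back by 1 / l gives
rho f <= l^r, so rho f = 0. *)
Lemma variable_norm_eq0 (f : Rn R n -> R) : measurable_fun setT f ->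
  variable_norm p f = 0 -> {ae mu, forall x, f x = 0%R}.
Proof.
move=> mf f0.
have mod_le (l : R) : (0 < l)%R -> (l <= 1)%R -> modular p f <= (l `^ r)%R%:E.
  move=> l0 l1.
  have : variable_norm p f < l%:E by rewrite f0 lte_fin.
  move=> /ereal_inf_lt[_ [l' [l'0 fl'] <-]]; rewrite lte_fin => l'l.
  have K1 : (1 <= l'^-1)%R by rewrite invf_ge1// (le_trans (ltW l'l)).
  have mfl : measurable_fun setT (fun x => f x / l')%R by exact: measurable_funM.
  have := modular_scale p_exp r01 pr K1 mfl.
  under eq_fun do rewrite invrK divfK ?gt_eqF//.
  move=> /le_trans; apply.
  have -> : ((l'^-1 `^ r)^-1 = l' `^ r)%R.
    by rewrite -(powR_inv1 (ltW l'0)) -powRrM mulN1r powRN invrK.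
  apply: (@le_trans _ _ ((l' `^ r)%R%:E * 1)).
    by rewrite lee_wpmul2l// lee_fin powR_ge0.
  by rewrite mule1 lee_fin; apply: ge0_ler_powR; rewrite ?nnegrE ltW.
have mod0 : modular p f = 0.
  apply/eqP; rewrite eq_le modular_ge0 andbT; apply/lee_addgt0Pr => e e0.
  rewrite add0e.
  pose l : R := Num.min 1%R (e `^ r^-1)%R.
  have l0 : (0 < l)%R by rewrite lt_min ltr01 powR_gt0.
  have l1 : (l <= 1)%R by rewrite ge_min lexx.
  apply: le_trans (mod_le l l0 l1) _; rewrite lee_fin -[leRHS]powR_rootK ?(ltW e0)//.
  apply: ge0_ler_powR; rewrite ?nnegrE ?powR_ge0 ?(ltW l0) ?(ltW r0)//.
  by rewrite ge_min lexx orbT.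
have : modular p f == 0 by rewrite mod0.
rewrite /modular padde_eq0 ?Lnorm_ge0//; last first.
  by apply: integral_ge0 => x _; rewrite lee_fin powR_ge0.
move=> /andP[/eqP int0 /eqP/Lnormy_eq0 sup0].
have : {ae mu, forall x, p x < +oo -> f x = 0%R}.
  have /ae_eq_integral_abs : \int[mu]_(x in [set x | p x < +oo])
      `|(`|f x| `^ fine (p x))%:E| = 0.
    rewrite -[RHS]int0; apply: eq_integral => x _.
    by rewrite gee0_abs// lee_fin powR_ge0.
  move=> /(_ (measurable_finite_exponent p_exp)
    (measurable_modular_integrand p_exp mf)).
  apply: filterS => x /= H px; have := H px => -[/powR_eq0_eq0 /eqP].
  by rewrite normr_eq0 => /eqP.
apply: filterS2 sup0 => x /= sx fx.
have [px|px] := eqVneq (p x) +oo; last by apply: fx; rewrite ltey.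
by move: sx; rewrite patchE mem_set// => -[].
Qed.

(** rho (1_Q) is at most |Q| + 1, and a large enough divisor brings it below 1. *)
Lemma variable_norm_indic_lty (Q : set (Rn R n)) : measurable Q -> mu Q < +oo ->
  variable_norm p \1_Q < +oo.
Proof.
move=> mQ Qfin.
have mQ1 : measurable_fun setT (\1_Q : Rn R n -> R) by exact: measurable_indic.
have mD := measurable_finite_exponent p_exp.
have [M M0 QM] : exists2 M : R, (0 <= M)%R & modular p \1_Q <= M%:E.
  exists (fine (mu Q) + 1)%R; first by rewrite addr_ge0// fine_ge0.
  rewrite EFinD; apply: leeD.
    rewrite fineK ?ge0_fin_numE//.
    apply: (@le_trans _ _ (\int[mu]_(x in [set x | p x < +oo]) (\1_Q x)%:E)).
      apply: (ge0_le_integral mu mD (fun x _ => integrand_ge0 p _ x)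
        (measurable_modular_integrand p_exp mQ1)).
      - by apply/measurable_EFinP/measurable_funTS.
      - move=> x Dx; rewrite lee_fin indicE; case: (x \in Q).
          by rewrite normr1 powR1.
        by rewrite normr0 powR0// gt_eqF// fine_exponent_gt0.
    rewrite integral_indic//; apply: le_measure; rewrite ?inE//.
    exact: measurableI.
  apply: Lnormy_le_cst => // x /=; rewrite patchE indicE.
  by case: ifP => _; case: (x \in Q); rewrite ?normr1 ?normr0 lee_fin.
have K1 : (1 <= (1 + M) `^ r^-1)%R by apply: powR_root_ge1; rewrite lerDl.
apply: (@le_lt_trans _ _ ((1 + M) `^ r^-1)%R%:E); last exact: ltry.
apply: variable_norm_le; first exact: lt_le_trans K1.
apply: le_trans (modular_scale p_exp r01 pr K1 mQ1) _.
rewrite powR_rootK ?addr_ge0// lee_pdivrMl ?mule1 ?ltr_wpDr//.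
by apply: le_trans QM _; rewrite lee_fin lerDr.
Qed.

End variable_norm.

(** * Reducing operators *)

Section weighted_average.
Context {R : realType} {m n : nat}.
Local Notation mu := (lebesgue R n).

Lemma measurable_sqrt : measurable_fun setT (@Num.sqrt R).
Proof. by apply: continuous_measurable_fun; exact: sqrt_continuous. Qed.

Lemma measurable_vnorm_mulmx d (T : measurableType d) (W : T -> 'M[R[i]]_m)
    (z : 'cV[R[i]]_m) :
  (forall i j, measurable_fun setT (fun x => complex.Re (W x i j)) /\
    measurable_fun setT (fun x => complex.Im (W x i j))) ->
  measurable_fun setT (fun x => vnorm (W x *m z)).
Proof.
move=> mW; apply: (measurableT_comp measurable_sqrt).
apply: measurable_sum => i.
have -> : (fun x => Normc.normc ((W x *m z) i 0) ^+ 2) = (fun x =>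
  (\sum_j (complex.Re (W x i j) * complex.Re (z j 0) -
      complex.Im (W x i j) * complex.Im (z j 0))) ^+ 2 +
  (\sum_j (complex.Re (W x i j) * complex.Im (z j 0) +
      complex.Im (W x i j) * complex.Re (z j 0))) ^+ 2).
  apply/funext => x; rewrite sqr_normc_ReIm !mxE !raddf_sum/=.
  by congr (_ ^+ 2 + _ ^+ 2); apply: eq_bigr => j _; case: (W x i j); case: (z j 0).
apply: measurable_funD; apply: measurable_funX; apply: measurable_sum => j;
  have [mRe mIm] := mW i j.
- by apply: measurable_funB; apply: measurable_funM.
- by apply: measurable_funD; apply: measurable_funM.
Qed.

Definition weighted_indic (W : Rn R n -> 'M[R[i]]_m) (Q : set (Rn R n))
  (z : 'cV[R[i]]_m) (x : Rn R n) : R := vnorm (W x *m z) * \1_Q x.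

Variables (p : Rn R n -> \bar R) (p_exp : variable_exponent p) (r : R).
Hypotheses (r01 : 0 < r <= 1) (pr : {ae mu, forall x, (r%:E <= p x)%E}).

Lemma variable_norm_indic_gt0 (Q : set (Rn R n)) :
  is_cube Q -> (0 < variable_norm p \1_Q)%E.
Proof.
move=> cQ; rewrite lt_neqAle variable_norm_ge0 andbT eq_sym; apply/eqP => Q0.
have mQ := measurable_cube cQ.
have mI : measurable_fun setT (\1_Q : Rn R n -> R) by exact: measurable_indic.
have ae0 := variable_norm_eq0 p_exp r01 pr mI Q0; have := lebesgue_cube_gt0 cQ.
suff -> : mu Q = 0%E by rewrite ltxx.
apply/negligibleP => //; apply: negligibleS ae0 => x Qx /=.
by rewrite indicE mem_set// => /eqP; rewrite oner_eq0.
Qed.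

Variables (W : Rn R n -> 'M[R[i]]_m) (Q : set (Rn R n)).
Hypotheses (W_weight : matrix_weight W) (Q_cube : is_cube Q).

Lemma measurable_weighted_indic z : measurable_fun setT (weighted_indic W Q z).
Proof.
apply: measurable_funM.
  apply: measurable_vnorm_mulmx => i j; have [_ /(_ i j)[[mRe _] [mIm _]]] := W_weight.
  by split.
by apply: measurable_indic; exact: measurable_cube.
Qed.

(** W is invertible almost everywhere, so |W z| 1_Q vanishes almost everywhere with
z != 0 only if Q is negligible. *)
Lemma weighted_indic_eq0 z : variable_norm p (weighted_indic W Q z) = 0%E -> z = 0.
Proof.
move=> /(variable_norm_eq0 p_exp r01 pr (measurable_weighted_indic z)) ae0.
apply: contrapT => /eqP z0; have := lebesgue_cube_gt0 Q_cube.
suff -> : mu Q = 0%E by rewrite ltxx.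
apply/negligibleP; first exact: measurable_cube.
suff : {ae mu, forall x, ~ Q x} by apply: negligibleS => x Qx /=.
have [aeW _] := W_weight; apply: filterS2 ae0 aeW => x /= fx [_ Wu] Qx.
move: fx; rewrite /weighted_indic indicE mem_set// mulr1 => /eqP.
rewrite vnorm_eq0 => /eqP Wz; move/eqP: z0; apply.
by rewrite -(mulKmx Wu z) Wz mulmx0.
Qed.

Hypothesis fin_norm :
  forall z, (variable_norm p (weighted_indic W Q z) < +oo)%E.

Lemma quasi_norm_weighted_average (s : R) : 0 < s ->
  quasi_norm (2 * 2 `^ r^-1)
    (fun z => s * fine (variable_norm p (weighted_indic W Q z))).
Proof.
move=> s0; have s0' := ltW s0; set N := fun z => variable_norm p (weighted_indic W Q z).
have N0 z : (0 <= N z)%E by exact: variable_norm_ge0.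
have Nfin z : N z \is a fin_num by rewrite ge0_fin_numE// fin_norm.
have NZ a z : a != 0 -> fine (N (a *: z)) = Normc.normc a * fine (N z).
  move=> a0; have na : 0 < Normc.normc a.
    by rewrite lt_neqAle normc_ge0 eq_sym normc_eq0 a0.
  rewrite -[RHS](@fineM _ (Normc.normc a)%:E (N z))// -variable_normZ//.
  congr (fine (variable_norm _ _)).
  by apply/funext => x; rewrite /weighted_indic -scalemxAr vnormZ mulrA.
rewrite -[X in quasi_norm _ X]/(fun z => s * fine (N z)); split.
- by move=> z; rewrite mulr_ge0// fine_ge0.
- move=> a z; have [->|a0] := eqVneq a 0; last by rewrite NZ// mulrCA.
  rewrite scale0r Normc.normc0 mul0r.
  have := NZ 2 0; rewrite scaler0 pnatr_eq0 normcMn Normc.normc1 => /(_ isT) N00.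
  by rewrite (_ : fine (N 0) = 0) ?mulr0//; lra.
- move=> z w; rewrite -mulrDr mulrCA ler_wpM2l//.
  rewrite -lee_fin EFinM EFinD !fineK//.
  have m2 u : measurable_fun setT (fun x => 2 * weighted_indic W Q u x).
    apply: measurable_funM; first exact: measurable_cst.
    exact: measurable_weighted_indic.
  have /= := variable_norm_quasi_triangle p_exp r01 pr
    (measurable_weighted_indic (z + w)) (m2 z) (m2 w).
  rewrite !variable_normZ// -ge0_muleDr ?variable_norm_ge0// muleCA muleA -EFinM; apply.
  move=> x; have i0 : 0 <= \1_Q x :> R by rewrite indicE ler0n.
  rewrite /weighted_indic !ger0_norm ?mulr_ge0 ?vnorm_ge0//.
  by rewrite !mulrA -mulrDl -mulrDr ler_wpM2r// mulmxDr vnormD.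
- move=> z /eqP; rewrite mulf_eq0 gt_eqF//= => /eqP Nz; apply: weighted_indic_eq0.
  by rewrite -[LHS]fineK ?Nfin// Nz.
Qed.

End weighted_average.

Theorem proposition3p9 (R : realType) (m n : nat) (hm : (0 < m)%N)
    (hn : (0 < n)%N) (p : Rn R n -> \bar R) (hp : variable_exponent p) :
  exists c C : R, [/\ 0 < c, 0 < C &
    forall (W : Rn R n -> 'M[R[i]]_m) (Q : set (Rn R n)),
      matrix_weight W -> is_cube Q ->
      (forall z : 'cV[R[i]]_m,
        (variable_norm p (fun x => vnorm (W x *m z) * \1_Q x)%R < +oo)%E) ->
      exists A : 'M[R[i]]_m, [/\ pos_definite A, A ^t* = A &
        forall z : 'cV[R[i]]_m,
          let avg := ((variable_norm p \1_Q)^-1 *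
            variable_norm p (fun x => vnorm (W x *m z) * \1_Q x)%R)%E in
          (c%:E * avg <= (vnorm (A *m z))%:E <= C%:E * avg)%E]].
Proof.
have [r [r01 pr]] := exponent_ge hp.
have K1 : 1 <= 2 * 2 `^ r^-1 :> R.
  have : 1 <= 2 `^ r^-1 :> R by apply: (powR_root_ge1 r01); lra.
  lra.
have [C [C0 equiv]] := quasi_norm_equiv_norm1 m K1.
have m0 : 0 < m%:R :> R by rewrite ltr0n.
exists (C * m%:R)^-1, C; split; rewrite ?invr_gt0 ?mulr_gt0//.
move=> W Q Ww Qc fin_norm.
have s_lty := variable_norm_indic_lty hp r01 pr (measurable_cube Qc)
  (lebesgue_cube_lty Qc).
have s_gt0 := variable_norm_indic_gt0 hp r01 pr Qc.
have s_fin : variable_norm p \1_Q \is a fin_num by rewrite ge0_fin_numE// ltW.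
pose s := fine (variable_norm p \1_Q).
have s0 : 0 < s by rewrite fine_gt0// s_gt0.
have si0 : 0 < s^-1 by rewrite invr_gt0.
pose N z := s^-1 * fine (variable_norm p (weighted_indic W Q z)).
have [B Bu BN] := equiv N (quasi_norm_weighted_average hp r01 pr Ww Qc fin_norm si0).
have [A [Apos Aherm AB]] := polar_decomposition Bu.
exists A; split; [exact: Apos|exact: Aherm|move=> z; cbv zeta].
have -> : ((variable_norm p \1_Q)^-1 *
    variable_norm p (fun x => vnorm (W x *m z) * \1_Q x)%R)%E = (N z)%:E.
  rewrite -(fineK s_fin) inver gt_eqF// EFinM fineK//.
  by rewrite ge0_fin_numE ?variable_norm_ge0// fin_norm.
rewrite AB -!EFinM !lee_fin; have [BNz NBz] := BN z; apply/andP; split.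
  rewrite ler_pdivrMl ?mulr_gt0// (le_trans NBz)// -mulrA ler_wpM2l ?(ltW C0)//.
  exact: norm1_le_vnorm.
exact: le_trans (vnorm_le_norm1 _) BNz.
Qed.
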